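(* Let $s>0$ and $\gamma=\gamma_0/h$ with $\gamma_0>0$. It holds $$L_h(v;\delta,\delta)\ge C\,\|\nabla\delta\|^2_\Omega\qquad\forall v,\delta\in V_h,$$ with the constant $C=1-\dfrac{C_I}{\gamma_0}$, independent of $v$, of $s$ and of $h$. In particular $C>0$, and the linearized form is coercive, provided $\gamma_0>C_I$.
   Context: $\Omega\subset\mathbb R^d$, $d\in\{2,3\}$, is a bounded polygonal or polyhedral Lipschitz domain whose boundary is decomposed into relatively open, disjoint parts $\Gamma_D,\Gamma_C$ with $|\Gamma_D|>0$ and $\overline\Gamma_D\cup\overline\Gamma_C=\partial\Omega$. $(\cdot,\cdot)_D$ and $\|\cdot\|_D$ denote the $L^2(D)$ inner product and norm. $V=\{v\in H^1(\Omega): v=0\text{ on }\Gamma_D\}$; the obstacle is $g\in H^{1/2}(\Gamma_C)$. $\mathcal T_h$ is a shape-regular, quasiuniform, boundary-fitted partition of $\Omega$ with mesh parameter $h\in(0,h_0]$, and $V_h\subset V\cap C^0(\overline\Omega)$ is the conforming finite element space of continuous piecewise polynomials of degree $k$. For $v\in V_h$, $\sigma_n(v)=\nabla v\cdot\mathbf n$ is taken on each contact face from its unique adjacent element. $C_I$ is the constant (independent of $h$) in the trace inverse inequality $\|\sigma_n(w)\|^2_{\Gamma_C}\le C_Ih^{-1}\|\nabla w\|^2_\Omega$ for all $w\in V_h$. Set $P(v)=(v-g)-\sigma_n(v)/\gamma$, $DP(w)=w-\sigma_n(w)/\gamma$, $\varphi_{+,s}(t)=t/2+\sqrt{t^2/4+s}$,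 $a_h(v,w)=(\nabla v,\nabla w)_\Omega-\gamma^{-1}(\sigma_n(v),\sigma_n(w))_{\Gamma_C}$, and define the linearized form (at $v$, in direction $\delta$) $$L_h(v;\delta,w)=a_h(\delta,w)+\gamma(\varphi_{+,s}'(P(v))\,DP(\delta),DP(w))_{\Gamma_C},\qquad v,\delta,w\in V_h.$$ *)

(* Defs.v *)
From HB Require Import structures.
From mathcomp Require Import all_boot all_order all_algebra.
From mathcomp Require Import all_classical all_reals all_analysis.
(* the notations of mpoly.v clash with those of MathComp-Analysis *)
From mathcomp Require mpoly.
Import (canonicals, coercions) mpoly.
Set Implicit Arguments.
Unset Strict Implicit.
Unset Printing Implicit Defensive.
Import Order.TTheory GRing.Theory Num.Theory.
Import numFieldNormedType.Exports.
Local Open Scope classical_set_scope.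
Local Open Scope ring_scope.

(* [mu_ext] is stated over a semiring of sets; on this alias every set
   is measurable, so that covers are unrestricted. *)
Definition all_measurable (T : Type) : Type := T.

HB.instance Definition _ (T : pointedType) := Pointed.on (all_measurable T).
HB.instance Definition _ (T : pointedType) :=
  @isMeasurable.Build default_measure_display (all_measurable T)
    discrete_measurable discrete_measurable0 discrete_measurableC
    discrete_measurableU.

Section cover_measure.
Context {R : realType} {T : pointedType}.
Implicit Types (zeta : set T -> \bar R) (A X : set T).
Local Open Scope ereal_scope.

Definition cover_gauge zeta A : \bar R := if A == set0 then 0 else zeta A.

Definition cover_measure zeta (X : set T) : \bar R :=
  mu_ext (cover_gauge zeta : set (all_measurable T) -> \bar R) X.

Variable zeta : set T -> \bar R.
Hypothesis zeta_ge0 : forall A, A !=set0 -> 0 <= zeta A.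

Lemma cover_gauge0 : cover_gauge zeta set0 = 0.
Proof. by rewrite /cover_gauge eqxx. Qed.

Lemma cover_gauge_ge0 A : 0 <= cover_gauge zeta A.
Proof. by rewrite /cover_gauge; case: ifPn => // /set0P/zeta_ge0. Qed.

Lemma cover_measure0 : cover_measure zeta set0 = 0.
Proof. exact: (@mu_ext0 _ (all_measurable T) R _ cover_gauge0 cover_gauge_ge0). Qed.

Lemma cover_measure_ge0 X : 0 <= cover_measure zeta X.
Proof. exact: (@mu_ext_ge0 _ (all_measurable T) R _ cover_gauge_ge0). Qed.

Lemma le_cover_measure : {homo cover_measure zeta : A B / A `<=` B >-> A <= B}.
Proof. exact: (@le_mu_ext _ (all_measurable T)). Qed.

Lemma cover_measure_sigma_subadditive : sigma_subadditive (cover_measure zeta).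
Proof. exact: (@mu_ext_sigma_subadditive _ (all_measurable T) R _ cover_gauge_ge0). Qed.

End cover_measure.

(* The library norm of 'rV_d is the maximum norm: it induces the right
   topology, but lengths and diameters below use the Euclidean norm. *)

Section euclidean.
Context {R : realType} {d : nat}.
Implicit Types (x y a b : 'rV[R]_d) (A X : set 'rV[R]_d).

Definition dot x y : R := \sum_i x ord0 i * y ord0 i.
Definition enorm x : R := Num.sqrt (dot x x).
Definition eball x (r : R) : set 'rV[R]_d := [set y | enorm (y - x) < r].

Definition diam A : \bar R :=
  ereal_sup [set (enorm (p.1 - p.2))%:E | p in A `*` A].

Definition box a b : set 'rV[R]_d :=
  [set x | forall i, a ord0 i <= x ord0 i <= b ord0 i].

Definition box_gauge A : \bar R :=
  ereal_inf [set (\prod_i (p.2 ord0 i - p.1 ord0 i))%:E | p in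
    [set p : 'rV[R]_d * 'rV[R]_d |
      (forall i, p.1 ord0 i <= p.2 ord0 i) /\ A `<=` box p.1 p.2]].

Definition lebesgue_outer (X : set 'rV[R]_d) : \bar R :=
  cover_measure box_gauge X.

Lemma box_gauge_ge0 A : A !=set0 -> (0 <= box_gauge A)%E.
Proof.
move=> _; apply: le_ereal_inf_tmp => _ [[a b] /= [ab _]] <-.
by rewrite lee_fin; apply: prodr_ge0 => i _; rewrite subr_ge0.
Qed.

HB.instance Definition _ := isOuterMeasure.Build R 'rV[R]_d lebesgue_outer
  (cover_measure0 box_gauge_ge0) (cover_measure_ge0 box_gauge_ge0)
  (@le_cover_measure _ _ box_gauge)
  (cover_measure_sigma_subadditive box_gauge_ge0).

Fixpoint unit_ball_volume (m : nat) : R :=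
  match m with
  | 0 => 1
  | 1 => 2
  | m'.+2 => 2 * pi / m%:R * unit_ball_volume m'
  end.

(* The factor omega_m / 2 ^ m makes the m-dimensional Hausdorff measure
   coincide with arc length (m = 1) and surface area (m = 2). *)
Definition hausdorff_gauge (m : nat) (e : R) A : \bar R :=
  if (diam A <= e%:E)%E
  then (unit_ball_volume m / 2 ^+ m * fine (diam A) ^+ m)%:E else +oo%E.

Definition hausdorff_outer (m : nat) (X : set 'rV[R]_d) : \bar R :=
  ereal_sup [set cover_measure (hausdorff_gauge m e) X | e in [set e | 0 < e]].

Lemma unit_ball_volume_ge0 m : 0 <= unit_ball_volume m.
Proof.
suff: 0 <= unit_ball_volume m /\ 0 <= unit_ball_volume m.+1 by case.
elim: m => [|m [IH0 IH1]]; first by split.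
split=> //; apply: mulr_ge0 => //.
by rewrite divr_ge0// mulr_ge0// pi_ge0.
Qed.

Lemma hausdorff_gauge_ge0 m e A : A !=set0 -> (0 <= hausdorff_gauge m e A)%E.
Proof.
move=> [x Ax]; rewrite /hausdorff_gauge; case: ifPn => // _.
rewrite lee_fin mulr_ge0// ?divr_ge0 ?exprn_ge0 ?unit_ball_volume_ge0//.
apply: fine_ge0; apply: (@le_trans _ _ (enorm (x - x))%:E).
  by rewrite lee_fin sqrtr_ge0.
by apply: ereal_sup_ubound; exists (x, x).
Qed.

Let haus0 m : hausdorff_outer m set0 = 0%E.
Proof.
rewrite /hausdorff_outer (_ : [set _ | _ in _] = [set 0%E]) ?ereal_sup1//.
apply/seteqP; split=> [_ [e _ <-]|_ ->] /=.
  exact: (cover_measure0 (@hausdorff_gauge_ge0 m e)).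
by exists 1 => //=; exact: (cover_measure0 (@hausdorff_gauge_ge0 m 1)).
Qed.

Let haus_ge0 m X : (0 <= hausdorff_outer m X)%E.
Proof.
apply: (le_trans (cover_measure_ge0 (@hausdorff_gauge_ge0 m 1) X)).
by apply: ereal_sup_ubound; exists 1 => //=.
Qed.

Let haus_le m : {homo hausdorff_outer m : A B / A `<=` B >-> (A <= B)%E}.
Proof.
move=> A B AB; apply: ge_ereal_sup => _ [e /= e0 <-].
apply: (le_trans (@le_cover_measure _ _ _ _ _ AB)).
by apply: ereal_sup_ubound; exists e.
Qed.

Let haus_sub m : sigma_subadditive (hausdorff_outer m).
Proof.
move=> F; apply: ge_ereal_sup => _ [e /= e0 <-].
apply: (le_trans (cover_measure_sigma_subadditive
  (@hausdorff_gauge_ge0 m e) F)).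
apply: lee_nneseries => n _.
  by move=> _; exact: (cover_measure_ge0 (@hausdorff_gauge_ge0 m e)).
by apply: ereal_sup_ubound; exists e.
Qed.

HB.instance Definition _ m := isOuterMeasure.Build R 'rV[R]_d
  (hausdorff_outer m) (haus0 m) (haus_ge0 m) (@haus_le m) (@haus_sub m).

End euclidean.

Section analysis.
Context {R : realType} {d : nat}.
Implicit Types (W Gam A : set 'rV[R]_d) (f g v : 'rV[R]_d -> R) (x n : 'rV[R]_d).

Definition volume_space := caratheodory_type (@lebesgue_outer R d).
HB.instance Definition _ := Measurable.on volume_space.
Definition volume : set volume_space -> \bar R := @lebesgue_outer R d.
HB.instance Definition _ := isMeasure.Build _ volume_space R volume
  (caratheodory_measure0 (@lebesgue_outer R d))
  (caratheodory_measure_ge0 (mu := @lebesgue_outer R d))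
  (caratheodory_measure_sigma_additive (mu := @lebesgue_outer R d)).

Definition surface_space := caratheodory_type (@hausdorff_outer R d d.-1).
HB.instance Definition _ := Measurable.on surface_space.
Definition surface : set surface_space -> \bar R := @hausdorff_outer R d d.-1.
HB.instance Definition _ := isMeasure.Build _ surface_space R surface
  (caratheodory_measure0 (@hausdorff_outer R d d.-1))
  (caratheodory_measure_ge0 (mu := @hausdorff_outer R d d.-1))
  (caratheodory_measure_sigma_additive (mu := @hausdorff_outer R d d.-1)).

Definition partial (i : 'I_d) f : 'rV[R]_d -> R :=
  fun x => 'D_(delta_mx ord0 i) f x.

(* For a piecewise polynomial f this is the weak gradient of f almost
   everywhere: it is classical inside each element, and has no meaning on
   the interfaces between elements, a null set. *)
Definition grad f x : 'rV[R]_d := \row_i partial i f x.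

Definition ip_grad W f g : R := \int[volume]_(x in W) dot (grad f x) (grad g x).
Definition norm_grad W f : R := Num.sqrt (ip_grad W f f).

Definition ip_surface Gam f g : R := \int[surface]_(x in Gam) (f x * g x).
Definition norm_surface Gam f : R := Num.sqrt (ip_surface Gam f f).

Definition L2 W f : Prop :=
  measurable_fun (W : set volume_space) (f : volume_space -> R) /\
  (\int[volume]_(x in W) ((f x) ^+ 2)%:E < +oo)%E.

Definition smooth f : Prop :=
  forall (l : seq 'I_d) x, differentiable (foldr partial f l) x.

Definition test_function W f : Prop :=
  smooth f /\ exists K : set 'rV[R]_d,
    [/\ compact K, K `<=` W & forall x, ~ K x -> f x = 0].

Definition weak_partial W (i : 'I_d) f g : Prop :=
  forall phi, test_function W phi ->
    \int[volume]_(x in W) (f x * partial i phi x)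
    = - \int[volume]_(x in W) (g x * phi x).

Definition H1 W f : Prop :=
  L2 W f /\ forall i, exists2 g, L2 W g & weak_partial W i f g.

(* Sobolev-Slobodeckij space on a (d-1)-dimensional set: the exponent of
   the kernel is (d - 1) + 2 * (1/2) = d *)
Definition H12 Gam g : Prop :=
  [/\ measurable_fun (Gam : set surface_space) (g : surface_space -> R),
      (\int[surface]_(x in Gam) ((g x) ^+ 2)%:E < +oo)%E &
      (\int[surface]_(x in Gam) \int[surface]_(y in Gam)
         ((g x - g y) ^+ 2 / enorm (x - y) ^+ d)%:E < +oo)%E].

Definition boundary W : set 'rV[R]_d := closure W `\` W°.

Definition is_outer_normal W x n : Prop :=
  enorm n = 1 /\
  exists2 r : R, 0 < r & forall y, eball x r y -> (W y <-> dot (y - x) n < 0).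

(* meaningful at the points of the boundary of a polyhedral domain that
   lie in the relative interior of a flat face, i.e. almost everywhere *)
Definition outer_normal W x : 'rV[R]_d := get (is_outer_normal W x).

(* locally, W is the strict subgraph of a Lipschitz function of the
   coordinates orthogonal to some direction u *)
Definition lipschitz_boundary W : Prop :=
  forall x0, boundary W x0 ->
  exists (u : 'rV[R]_d) (psi : 'rV[R]_d -> R) (U : set 'rV[R]_d),
  [/\ enorm u = 1, [lipschitz psi x | x in setT], nbhs x0 U &
      forall y, U y -> (W y <-> dot y u < psi (y - dot y u *: u))].

End analysis.

Record polytope (R : realType) (d : nat) := Polytope {
  nfacets : nat ;
  fnormal : 'I_nfacets -> 'rV[R]_d ;
  foffset : 'I_nfacets -> R }.

Record mesh (R : realType) (d : nat) := Mesh {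
  nelem : nat ;
  elem : 'I_nelem -> polytope R d }.

Section meshes.
Context {R : realType} {d : nat}.
Implicit Types (P : polytope R d) (T : mesh R d) (W GD GC : set 'rV[R]_d).

Definition pset P : set 'rV[R]_d :=
  [set x | forall j : 'I_(nfacets P), dot (fnormal j) x <= foffset j].

Definition open_facet P (j : 'I_(nfacets P)) : set 'rV[R]_d :=
  [set x | dot (fnormal j) x = foffset j /\
           forall i : 'I_(nfacets P), i != j -> dot (fnormal i) x < foffset i].

(* a bounded convex polygon / polyhedron with nonempty interior, given by
   an irredundant system of half-spaces with unit outward normals *)
Definition is_polytope P : Prop :=
  [/\ forall j : 'I_(nfacets P), enorm (fnormal j) = 1,
      bounded_set (pset P),
      (pset P)° !=set0 &
      forall j : 'I_(nfacets P), open_facet j !=set0].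

Definition polyhedral W : Prop :=
  exists T : mesh R d, (forall i : 'I_(nelem T), is_polytope (elem i)) /\
    closure W = \bigcup_(i : 'I_(nelem T)) pset (elem i).

Definition polyhedral_lipschitz_domain W : Prop :=
  [/\ [/\ W !=set0, open W, connected W & bounded_set W],
      polyhedral W & lipschitz_boundary W].

Definition boundary_decomposition W GD GC : Prop :=
  [/\ exists2 O, open O & GD = O `&` boundary W,
      exists2 O, open O & GC = O `&` boundary W,
      GD `&` GC = set0 &
      closure GD `|` closure GC = boundary W].

Definition is_partition W T : Prop :=
  [/\ forall i : 'I_(nelem T), is_polytope (elem i),
      closure W = \bigcup_(i : 'I_(nelem T)) pset (elem i) &
      forall i j : 'I_(nelem T), i != j ->
        (pset (elem i))° `&` (pset (elem j))° = set0].

Definition boundary_fitted W GD GC T : Prop :=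
  forall (i : 'I_(nelem T)) (j : 'I_(nfacets (elem i))),
    [\/ open_facet j `<=` W, open_facet j `<=` closure GD
      | open_facet j `<=` closure GC].

Implicit Types (hs : set R) (Th : R -> mesh R d).

Definition mesh_parameter hs Th : Prop :=
  forall h, hs h -> forall i : 'I_(nelem (Th h)),
    (diam (pset (elem i)) <= h%:E)%E.

Definition shape_regular hs Th : Prop :=
  exists2 kappa : R, 0 < kappa &
  forall h, hs h -> forall i : 'I_(nelem (Th h)),
  exists x r, [/\ 0 < r, eball x r `<=` pset (elem i) &
    (diam (pset (elem i)) <= (kappa * r)%:E)%E].

Definition quasiuniform hs Th : Prop :=
  exists2 c : R, 0 < c &
  forall h, hs h -> forall i : 'I_(nelem (Th h)),
    ((c * h)%:E <= diam (pset (elem i)))%E.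

(* Th h is only constrained for h in the set hs of admissible mesh
   parameters *)
Definition mesh_family W GD GC hs Th : Prop :=
  [/\ forall h, hs h ->
        is_partition W (Th h) /\ boundary_fitted W GD GC (Th h),
      mesh_parameter hs Th, shape_regular hs Th & quasiuniform hs Th].

End meshes.

Section linearized_form.
Context {R : realType} {d : nat}.
Implicit Types (W GD GC : set 'rV[R]_d) (T : mesh R d).
Implicit Types (g v w delta : 'rV[R]_d -> R) (gam s : R).

(* V /\ C^0(closure W); the trace of a continuous function is its
   restriction to the boundary *)
Definition V_C0 W GD v : Prop :=
  [/\ H1 W v, {within closure W, continuous v} & forall x, GD x -> v x = 0].

Definition poly_on (k : nat) (A : set 'rV[R]_d) v : Prop :=
  exists2 p : mpoly.mpoly d R, (mpoly.msize p <= k.+1)%N &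
    forall x, A x -> v x = mpoly.meval (fun i => x ord0 i) p.

Definition fe_space W GD T (k : nat) v : Prop :=
  V_C0 W GD v /\ forall i : 'I_(nelem T), poly_on k (pset (elem i)) v.

(* gradient at a boundary point x, taken from an element containing x,
   which is unique outside a null set of boundary points *)
Definition boundary_grad T v (x : 'rV[R]_d) : 'rV[R]_d :=
  match [pick i : 'I_(nelem T) | x \in pset (elem i)] with
  | Some i => lim (grad v y @[y --> within (pset (elem i))° (nbhs x)])
  | None => 0
  end.

Definition sigma_n W T v (x : 'rV[R]_d) : R :=
  dot (boundary_grad T v x) (outer_normal W x).

Definition Pop W T gam g v (x : 'rV[R]_d) : R :=
  (v x - g x) - sigma_n W T v x / gam.

Definition DPop W T gam w (x : 'rV[R]_d) : R := w x - sigma_n W T w x / gam.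

Definition phi_plus s (t : R) : R := t / 2 + Num.sqrt (t ^+ 2 / 4 + s).

Definition a_h W GC T gam v w : R :=
  ip_grad W v w - gam^-1 * ip_surface GC (sigma_n W T v) (sigma_n W T w).

Definition L_h W GC T gam s g v delta w : R :=
  a_h W GC T gam delta w +
  gam * ip_surface GC
    (fun x => derive1 (phi_plus s) (Pop W T gam g v x) * DPop W T gam delta x)
    (DPop W T gam w).

Definition trace_inverse W GD GC hs (Th : R -> mesh R d) (k : nat) (CI : R) :=
  forall h, hs h -> forall w, fe_space W GD (Th h) k w ->
    norm_surface GC (sigma_n W (Th h) w) ^+ 2 <= CI * h^-1 * norm_grad W w ^+ 2.

(* coercivity with respect to the energy norm of grad w over W, which is
   a norm on functions vanishing on a part of the boundary of positive
   measure *)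
Definition coercive W (Vh : ('rV[R]_d -> R) -> Prop)
    (B : ('rV[R]_d -> R) -> ('rV[R]_d -> R) -> R) : Prop :=
  exists2 alpha : R, 0 < alpha &
    forall w, Vh w -> alpha * norm_grad W w ^+ 2 <= B w w.

End linearized_form.

(* Main.v *)
(* Since phi_plus is nondecreasing, the contact term of L_h(v; delta, delta) is
   a weighted square and can be dropped; the trace inverse inequality bounds the
   remaining negative term by (CI / gamma0) ||grad delta||^2, as 1 / gamma =
   h / gamma0 cancels the factor 1 / h. *)

Require Import Defs.
From mathcomp Require Import all_boot all_order all_algebra.
From mathcomp Require Import all_classical all_reals all_analysis.
From mathcomp Require Import ring lra.
Import Order.TTheory GRing.Theory Num.Theory.
Import numFieldNormedType.Exports.
Local Open Scope classical_set_scope.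
Local Open Scope ring_scope.

Section nonnegativity.
Context {R : realType} {d : nat}.
Implicit Types (W Gam : set 'rV[R]_d) (f g : 'rV[R]_d -> R).

(** [Num.sqrt] vanishes on negative reals, so the sign of the integral matters. A pointwise
    nonnegative integrand gives a nonnegative real even if its integral is infinite, the value then
    being 0. *)
Lemma sqr_norm_grad W f : norm_grad W f ^+ 2 = ip_grad W f f.
Proof.
apply: sqr_sqrtr; apply: Rintegral_ge0 => x _.
by apply: sumr_ge0 => i _; rewrite -expr2 sqr_ge0.
Qed.

Lemma sqr_norm_surface Gam f : norm_surface Gam f ^+ 2 = ip_surface Gam f f.
Proof.
by apply: sqr_sqrtr; apply: Rintegral_ge0 => x _; rewrite -expr2 sqr_ge0.
Qed.

(** Serves for the contact term, with the derivative of [phi_plus s] at [Pop] as weight [f] and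
    [DPop] of [delta] as [g]. *)
Lemma ip_surface_weight_ge0 Gam f g : (forall x, 0 <= f x) ->
  0 <= ip_surface Gam (fun x => f x * g x) g.
Proof.
move=> f0; apply: Rintegral_ge0 => x _.
by rewrite -mulrA -expr2 mulr_ge0 ?sqr_ge0.
Qed.

End nonnegativity.

(** With [q] the square root of [t ^+ 2 / 4 + s], the derivative is [(q + t / 2) / (2 * q)], and [q]
    dominates the absolute value of [t / 2]. *)
Lemma derive1_phi_plus_ge0 (R : realType) (s t : R) : 0 < s ->
  0 <= derive1 (phi_plus s) t.
Proof.
move=> s0.
(* The radicand stays away from 0, where the square root is not differentiable. *)
have X0 : 0 < t ^+ 2 / 4 + s by rewrite ltr_wpDl// divr_ge0// sqr_ge0.
have Dq : is_derive t (1 : R) (fun u : R => u ^+ 2 / 4 + s) (t / 2).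
  by apply: is_derive_eq; rewrite /GRing.scale/=; field.
have Ds := is_derive1_sqrt X0.
have Dsq := @is_derive1_comp _ Num.sqrt (fun u => u ^+ 2 / 4 + s) t _ _ Ds Dq.
have Dl : is_derive t (1 : R) (fun u : R => u / 2) 2^-1.
  by apply: is_derive_eq; rewrite /GRing.scale/= ?mulr0 ?add0r ?mulr1.
have Dphi : is_derive t (1 : R) (phi_plus s)
    (2^-1 + (2 * Num.sqrt (t ^+ 2 / 4 + s))^-1 * (t / 2)).
  exact: is_deriveD Dl Dsq.
rewrite derive1E derive_val.
set q := Num.sqrt _.
have q0 : 0 < q by rewrite sqrtr_gt0.
have tq : `|t / 2| <= q.
  rewrite -sqrtr_sqr; apply: ler_wsqrtr.
  have -> : (t / 2) ^+ 2 = t ^+ 2 / 4 by field.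
  by rewrite lerDl ltW.
have -> : 2^-1 + (2 * q)^-1 * (t / 2) = (q + t / 2) / (2 * q).
  by field; rewrite gt_eqF.
rewrite divr_ge0 ?mulr_ge0 ?(ltW q0)//.
by move: tq; rewrite ler_norml; lra.
Qed.

Theorem lemma4p2 (R : realType) (d : nat) (Omega GammaD GammaC : set 'rV[R]_d)
    (g : 'rV[R]_d -> R) (k : nat) (h0 : R) (hs : set R) (Th : R -> mesh R d)
    (CI gamma0 : R) :
  (d = 2 \/ d = 3)%N ->
  polyhedral_lipschitz_domain Omega ->
  boundary_decomposition Omega GammaD GammaC ->
  (0 < surface GammaD)%E ->
  H12 GammaC g ->
  0 < h0 -> hs `<=` [set h | 0 < h <= h0] ->
  mesh_family Omega GammaD GammaC hs Th ->
  trace_inverse Omega GammaD GammaC hs Th k CI ->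
  0 < gamma0 ->
  (forall s h : R, 0 < s -> hs h ->
    forall v delta, fe_space Omega GammaD (Th h) k v ->
      fe_space Omega GammaD (Th h) k delta ->
      L_h Omega GammaC (Th h) (gamma0 / h) s g v delta delta
        >= (1 - CI / gamma0) * norm_grad Omega delta ^+ 2)
  /\
  (CI < gamma0 ->
    0 < 1 - CI / gamma0 /\
    forall s h : R, 0 < s -> hs h ->
      forall v, fe_space Omega GammaD (Th h) k v ->
        coercive Omega (fe_space Omega GammaD (Th h) k)
          (L_h Omega GammaC (Th h) (gamma0 / h) s g v)).
Proof.
move=> _ _ _ _ _ _ hsub _ trace gamma0_gt0.
have coer s h : 0 < s -> hs h -> forall v delta,
    fe_space Omega GammaD (Th h) k v -> fe_space Omega GammaD (Th h) k delta ->
    (1 - CI / gamma0) * norm_grad Omega delta ^+ 2 <=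
    L_h Omega GammaC (Th h) (gamma0 / h) s g v delta delta.
  move=> s0 hh v delta _ fed.
  have /andP[h_gt0 _] : 0 < h <= h0 by exact: hsub.
  have gam_gt0 : 0 < gamma0 / h by exact: divr_gt0.
  rewrite /L_h /a_h -sqr_norm_grad -sqr_norm_surface.
  (* Drop the nonnegative contact term. *)
  apply: ler_wpDr.
    rewrite mulr_ge0 ?(ltW gam_gt0)//; apply: ip_surface_weight_ge0 => x.
    exact: derive1_phi_plus_ge0.
  rewrite mulrBl mul1r lerD2l lerN2.
  (* Factor out [(gamma0 / h)^-1] so that what remains is the right-hand side of the trace
     inequality for [delta]. *)
  have -> : CI / gamma0 * norm_grad Omega delta ^+ 2 =
      (gamma0 / h)^-1 * (CI * h^-1 * norm_grad Omega delta ^+ 2).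
    by field; rewrite !gt_eqF.
  by rewrite ler_pM2l ?invr_gt0//; exact: trace.
split=> // CIlt.
have C_gt0 : 0 < 1 - CI / gamma0 by rewrite subr_gt0 ltr_pdivrMr ?mul1r.
(* The same coercivity constant serves for all [s], [h] and [v]. *)
split=> // s h s0 hh v fev; exists (1 - CI / gamma0) => // w few.
exact: coer.
Qed.
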